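(* Let $F$ be a field of characteristic zero and let $\alpha,\beta\in F\setminus\{0\}$ with $\alpha\neq\beta$. Any proper subvariety of $\mathrm{var}^{tr}(D_2^{t_{\alpha,\beta}})$ generated by a finite dimensional algebra with trace has polynomial growth.
   Context: $F$ is a field of characteristic 0. An algebra with trace is a unitary associative $F$-algebra $A$ with an $F$-linear map $\mathrm{tr}:A\to F$ such that $\mathrm{tr}(ab)=\mathrm{tr}(ba)$; a scalar is identified with the corresponding multiple of $1_A$. The free algebra with trace $F\langle X,\mathrm{Tr}\rangle\cong F\langle X\rangle\otimes F[\mathrm{Tr}(M)]$ on $X=\{x_1,x_2,\dots\}$ is generated by the free unitary associative algebra $F\langle X\rangle$ and central commuting indeterminates $\mathrm{Tr}(M)$, $M$ a nonempty word in $X$, subject to $\mathrm{Tr}(MN)=\mathrm{Tr}(NM)$ and $\mathrm{Tr}(\mathrm{Tr}(M)N)=\mathrm{Tr}(M)\mathrm{Tr}(N)$. An element is a trace identity of $A$ if it becomes $0$ whenever the variables are replaced by arbitrary elements of $A$ and $\mathrm{Tr}$ by $\mathrm{tr}$; $\mathrm{Id}^{tr}(A)$ is the set of trace identities of $A$. $MT_n$ is the space of multilinear elements of $F\langle X,\mathrm{Tr}\rangle$ in $x_1,\dots,x_n$ (the span of all products of traces of words times a word in which each of $x_1,\dots,x_n$ occurs exactly once in total), and $c_n^{tr}(A)=\dim_F MT_n/(MT_n\cap \mathrm{Id}^{tr}(A))$. The variety $\mathrm{var}^{tr}(A)$ generated by $A$ is the class of all algebras with trace satisfying all trace identities of $A$;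 it has polynomial growth if $c_n^{tr}(A)$ is bounded above by a polynomial in $n$. $D_2$ is the algebra of $2\times2$ diagonal matrices over $F$, and $D_2^{t_{\alpha,\beta}}$ is $D_2$ with trace $t_{\alpha,\beta}(\mathrm{diag}(a,b))=\alpha a+\beta b$. *)

(* Defs.v *)
From HB Require Import structures.
From mathcomp Require Import all_boot all_order all_algebra all_field.
From mathcomp Require Import finmap.
From mathcomp.multinomials Require Import monalg.

Set Implicit Arguments.
Unset Strict Implicit.
Unset Printing Implicit Defensive.

Import GRing.Theory Num.Theory.
Local Open Scope quotient_scope.
Local Open Scope ring_scope.

Record traceAlg (F : fieldType) := TraceAlg {
  trcar :> algType F;
  tr : {scalar trcar};
  trC : forall a b : trcar, tr (a * b) = tr (b * a)
}.
Arguments tr {F} t.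

(* The letter i : nat stands for the variable x_(i+1). *)
Definition nword := {w : seq nat | w != [::]}.

Definition word_conj (u v : nword) : bool :=
  has (fun k => val v == rot k (val u)) (iota 0 (size (val u)).+1).

Lemma word_conjP (u v : nword) :
  reflect (exists s t, val u = s ++ t /\ val v = t ++ s) (word_conj u v).
Proof.
apply: (iffP hasP) => [[k _ /eqP ->]|[s [t [eu ev]]]].
  by exists (take k (val u)), (drop k (val u)); rewrite cat_take_drop.
exists (size s); last by rewrite ev eu rot_size_cat.
by rewrite mem_iota /= add0n ltnS eu size_cat leq_addr.
Qed.

Lemma word_conj_refl : reflexive word_conj.
Proof. by move=> u; apply/word_conjP; exists [::], (val u); rewrite cats0. Qed.

Lemma word_conj_sym : symmetric word_conj.
Proof.
move=> u v; apply/idP/idP => /word_conjP[s [t [eu ev]]];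
  by apply/word_conjP; exists t, s.
Qed.

Lemma word_conj_trans : transitive word_conj.
Proof.
move=> v u w /hasP[k kP /eqP evu] /hasP[l lP /eqP ewv].
have lek : (k <= size (val u))%N by move: kP; rewrite mem_iota /= add0n ltnS.
have lel : (l <= size (val u))%N.
  by move: lP; rewrite mem_iota /= add0n ltnS evu size_rot.
apply/hasP; exists (if l + k <= size (val u) then l + k else l + k - size (val u))%N.
  rewrite mem_iota /= add0n ltnS; case: (leqP (l + k)%N (size (val u))) => // _.
  by rewrite leq_subLR leq_add.
by rewrite ewv evu rot_add_mod.
Qed.

Canonical word_conj_equiv :=
  EquivRel word_conj word_conj_refl word_conj_sym word_conj_trans.

(* A cyclic word stands for the indeterminate Tr(M); passing to the quotient   *)
(* imposes Tr(MN) = Tr(NM). There is no indeterminate Tr(1).                   *)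
Definition cword := {eq_quot word_conj}.
HB.instance Definition _ := Choice.on cword.

Section ProdMonom.
Variables M N : monomType.
Implicit Types x y : (M * N)%type.

Definition pmone : M * N := (mone, mone).
Definition pmmul x y : M * N := (mmul x.1 y.1, mmul x.2 y.2).

Fact pmmulA : associative pmmul.
Proof. by move=> x y z; rewrite /pmmul /= !mulmA. Qed.
Fact pmmul1m : left_id pmone pmmul.
Proof. by case=> x y; rewrite /pmmul /= !mul1m. Qed.
Fact pmmulm1 : right_id pmone pmmul.
Proof. by case=> x y; rewrite /pmmul /= !mulm1. Qed.
Fact pm_unitm x y : pmmul x y = pmone -> x = pmone /\ y = pmone.
Proof.
by case: x y => [x1 x2] [y1 y2] [] /unitm[-> ->] /unitm[-> ->].
Qed.

HB.instance Definition _ :=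
  Choice_isMonomialDef.Build (M * N)%type pmmulA pmmul1m pmmulm1 pm_unitm.
End ProdMonom.

Fact malg_scalerAr (K : monomType) (F : fieldType) (c : F) (f g : {malg F[K]}) :
  c *: (f * g) = f * (c *: g).
Proof.
have cf : c%:MP * f = f * c%:MP.
  rewrite !malgM_def fgmulUg fgmulgU; apply: eq_bigr => k _.
  by rewrite mul1m mulm1 mulrC.
by rewrite -!mul_malgC mulrA cf -mulrA.
Qed.

(* (m, w) stands for (\prod_c Tr(c) ^ (m c)) * w. *)
Definition tmonom := ({cmonom cword} * {fmonom nat})%type.
HB.instance Definition _ := MonomialDef.on tmonom.

(* The monoid algebra of a product monoid: F[Tr(M)] (x) F<X>. *)
Definition free_trace_alg (F : fieldType) := {malg F[tmonom]}.
HB.instance Definition _ (F : fieldType) := GRing.Lalgebra.on (free_trace_alg F).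

HB.instance Definition _ (F : fieldType) :=
  GRing.Lalgebra_isAlgebra.Build F (free_trace_alg F) (@malg_scalerAr tmonom F).

Definition cletters (c : cword) : seq nat := val (repr c).

Section Evaluation.
Variables (F : fieldType) (A : traceAlg F) (a : nat -> A).

Definition word_eval (w : seq nat) : A := \prod_(i <- w) a i.

Definition cword_eval (c : cword) : F := tr A (word_eval (cletters c)).

(* Traces do not depend on the representative chosen by repr. *)
Lemma cword_evalE (w : nword) :
  cword_eval (\pi_cword w) = tr A (word_eval (val w)).
Proof.
have : word_conj (repr (\pi_cword w)) w.
  by rewrite -[word_conj _ _]/(word_conj_equiv _ _) -eqmodE reprK.
case/word_conjP=> s [t [es et]].
by rewrite /cword_eval /cletters es et /word_eval !big_cat /= trC.
Qed.

Definition tmonom_eval (m : tmonom) : A :=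
  (\prod_(c <- finsupp m.1) cword_eval c ^+ m.1 c) *: word_eval m.2.

Lemma tmonom_evalEw (m : tmonom) (d : {fset cword}) : (finsupp m.1 `<=` d)%fset ->
  tmonom_eval m = (\prod_(c <- d) cword_eval c ^+ m.1 c) *: word_eval m.2.
Proof.
move=> le; rewrite /tmonom_eval; congr (_ *: _).
by apply: big_fset_incl => // c _ /fsfun_dflt ->.
Qed.

Fact tmonom_eval_mmorphism : mmorphism tmonom_eval.
Proof.
split=> [[m1 w1] [m2 w2]|]; last first.
  by rewrite /tmonom_eval /word_eval /= mdom1 big_seq_fset0 scale1r fm1 big_nil.
pose d := (finsupp m1 `|` finsupp m2)%fset.
rewrite !(@tmonom_evalEw _ d) /= ?mdomD ?fsubsetUl ?fsubsetUr //.
rewrite -scalerAl -scalerAr scalerA /word_eval fmM big_cat -big_split /=.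
by congr (_ *: _); apply: eq_bigr => c _; rewrite cmM exprD.
Qed.
HB.instance Definition _ :=
  isMultiplicative.Build tmonom A tmonom_eval tmonom_eval_mmorphism.

(* The algebra morphism x_i |-> a i, Tr(M) |-> tr(M(a)).                        *)
Definition tr_eval (f : free_trace_alg F) : A := mmap (in_alg A) tmonom_eval f.
End Evaluation.

Definition trace_identity (F : fieldType) (A : traceAlg F)
    (f : free_trace_alg F) : Prop :=
  forall a : nat -> A, tr_eval a f = 0.

Definition tdeg (i : nat) (m : tmonom) : nat :=
  (\sum_(c <- finsupp m.1) m.1 c * count_mem i (cletters c)
   + count_mem i (m.2 : seq nat))%N.

Definition multilinear_tmonom (n : nat) (m : tmonom) : Prop :=
  forall i, tdeg i m = (i < n)%N.

Definition MT (F : fieldType) (n : nat) (f : free_trace_alg F) : Prop :=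
  forall m, m \in msupp f -> multilinear_tmonom n m.

(* For subspaces W <= V of E: dim V/W = d, witnessed by a basis of V modulo W. *)
Definition quotient_dim (F : fieldType) (E : lmodType F) (V W : E -> Prop)
    (d : nat) : Prop :=
  exists v : 'I_d -> E,
    [/\ forall i, V (v i),
        forall c : 'I_d -> F, W (\sum_i c i *: v i) -> forall i, c i = 0
      & forall x, V x -> exists c : 'I_d -> F, W (x - \sum_i c i *: v i)].

(* c_n^tr(A) = d *)
Definition trace_codim (F : fieldType) (A : traceAlg F) (n d : nat) : Prop :=
  quotient_dim (@MT F n) (fun f => MT n f /\ trace_identity A f) d.

(* The existence of d is part of the assertion, so an undefined codimension    *)
(* could not make it vacuous.                                                  *)
Definition polynomial_growth (F : fieldType) (A : traceAlg F) : Prop :=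
  exists p : {poly rat}, forall n : nat,
    exists2 d : nat, trace_codim A n d & d%:R <= p.[n%:R].

Definition variety (F : fieldType) (A : traceAlg F) : traceAlg F -> Prop :=
  fun B => forall f, trace_identity A f -> trace_identity B f.

Definition proper_subvariety (F : fieldType) (V W : traceAlg F -> Prop) : Prop :=
  (forall B, V B -> W B) /\ (exists2 B, W B & ~ V B).

Section Diag2.
Variable F : fieldType.

Definition diag2_pred : pred 'M[F]_2 := fun A => is_diag_mx A.

Record diag2 : predArgType := Diag2 { diag2_mx :> 'M[F]_2; _ : diag2_pred diag2_mx }.

HB.instance Definition _ := [isSub for diag2_mx].
HB.instance Definition _ := [Choice of diag2 by <:].

Fact diag2_closed : subalg_closed diag2_pred.
Proof.
split; first exact: scalar_mx_is_diag.
- move=> a u v /is_diag_mxP Du /is_diag_mxP Dv; apply/is_diag_mxP => i j nij.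
  by rewrite !mxE Du // Dv // mulr0 addr0.
- move=> u v /diag_mxP[d ->] /diag_mxP[e ->].
  by rewrite unfold_in -[_ * _]/(_ *m _) mulmx_diag; apply: diag_mx_is_diag.
Qed.

HB.instance Definition _ :=
  GRing.SubChoice_isSubAlgebra.Build F 'M[F]_2 diag2_pred diag2
    (GRing.subalg_closed_semi diag2_closed).

Variables alpha beta : F.

Definition diag2_tr (d : diag2) : F :=
  alpha * diag2_mx d 0 0 + beta * diag2_mx d 1 1.

Fact diag2_tr_scalar : scalar diag2_tr.
Proof.
have valE i : {morph (fun d : diag2 => diag2_mx d i i) : u v / u + v}.
  by move=> u v; rewrite mxE.
have valZ i a (u : diag2) : diag2_mx (a *: u) i i = a * diag2_mx u i i.
  by rewrite mxE.
move=> a u v; rewrite /diag2_tr !valE !valZ !mulrDr.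
by rewrite !(mulrCA a) addrACA.
Qed.

HB.instance Definition _ :=
  GRing.isLinear.Build F diag2 F *%R diag2_tr diag2_tr_scalar.

Fact diag2_trC (u v : diag2) : diag2_tr (u * v) = diag2_tr (v * u).
Proof.
suff -> : u * v = v * u by [].
apply: val_inj; case: u v => [u Du] [v Dv] /=; move: Du Dv.
rewrite /diag2_pred => /diag_mxP[d ->] /diag_mxP[e ->].
rewrite -[_ * _]/(_ *m _) -[RHS]/(_ *m _) !mulmx_diag.
by congr diag_mx; apply/rowP => i; rewrite !mxE mulrC.
Qed.

Definition D2 : traceAlg F := @TraceAlg F diag2 diag2_tr diag2_trC.
End Diag2.

(* Main.v *)
From HB Require Import structures.
Require Import Defs.
From mathcomp Require Import all_boot all_order all_algebra all_field.
From mathcomp Require Import finmap ring zify.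
From mathcomp.multinomials Require Import monalg.
From Stdlib Require Import Classical.

Set Implicit Arguments.
Unset Strict Implicit.
Unset Printing Implicit Defensive.

Import Order.TTheory GRing.Theory Num.Theory.
Local Open Scope ring_scope.

(** Write D for the algebra of diagonal matrices with trace alpha a + beta b,
    and let A satisfy all trace identities of D.  Four explicit identities of D
    decide everything: commutativity, two identities about the Casimir element
    below, and an identity of degree three in one variable.

    For x, y in D let G be the Gram determinant of the trace form on x, y.  When
    G is not 0, let w be the sum of the products of the elements of a basis with
    those of its dual basis for the trace form; the trace polynomial W = G w
    (casimir) makes sense in every algebra with trace.  In D one has
    w = diag(1/alpha, 1/beta), so that U_s = s W - G is, for s = beta and for
    s = alpha, a multiple of the first and of the second idempotent of D
    respectively.  This yields the identities U_beta U_alpha = 0 (D2_shiftM)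
    and (s - r) G U_s y = t(U_s y) U_s (D2_shift_eigen).

    Suppose first that the determinant G of x, 1 is not 0 for some x in A.  The
    second identity at y = 1 forces t(1) = alpha + beta, and then the suitably
    scaled U_beta and U_alpha are complementary orthogonal idempotents of A with
    traces alpha and beta.  Hence D embeds in A (diag2_of_gram), A and D have
    the same identities, and var(A) is not a proper subvariety.

    Otherwise t(1) t(x^2) = t(x)^2 for all x, and, by polarization,
    t(1) t(xy) = t(x) t(y).  If t(1) = 0 then t = 0, and A is commutative with
    zero trace: its codimensions are at most 1 (growth_trace0).  If t(1) is not 0
    then t / t(1) is a character and A = F + N, where N = ker t is an ideal; the
    cubic identity gives n^3 = 0 on N, hence uvw = 0 for u, v, w in N
    (ker_tr_mul3).  A multilinear trace monomial evaluated at
    x_i = lambda_i + n_i is then a combination of the products which take n_i at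
    no more than two indices i and lambda_i elsewhere, so that
    c_n(A) <= 1 + n + n^2 (growth_character). *)

(** * Trace polynomials as operations on algebras with trace *)

Section TraceLaws.
Variable F : fieldType.

Lemma tr_eval_zmod (B : traceAlg F) (a : nat -> B) : zmod_morphism (tr_eval a).
Proof. exact: mmap_is_additive. Qed.

Lemma tr_eval_monoid (B : traceAlg F) (a : nat -> B) :
  monoid_morphism (tr_eval a).
Proof.
have [evM ev1] : multiplicative (tr_eval a).
  apply: commr_mmap_is_multiplicative => g m m'.
  by rewrite /GRing.comm /= mulr_algl mulr_algr.
by split.
Qed.

Lemma tr_evalZ (B : traceAlg F) (a : nat -> B) : scalable (tr_eval a).
Proof. by move=> c f; rewrite /tr_eval mmapZ /= mulr_algl. Qed.

HB.instance Definition _ (B : traceAlg F) (a : nat -> B) :=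
  GRing.isZmodMorphism.Build (free_trace_alg F) B (tr_eval a) (tr_eval_zmod a).
HB.instance Definition _ (B : traceAlg F) (a : nat -> B) :=
  GRing.isMonoidMorphism.Build (free_trace_alg F) B (tr_eval a)
    (tr_eval_monoid a).
HB.instance Definition _ (B : traceAlg F) (a : nat -> B) :=
  GRing.isScalable.Build F (free_trace_alg F) B *:%R (tr_eval a) (tr_evalZ a).

Lemma tr_evalU (B : traceAlg F) (a : nat -> B) (m : tmonom) :
  tr_eval a << m >> = tmonom_eval a m.
Proof. by rewrite /tr_eval mmapU /= scale1r mul1r. Qed.

Lemma tr_evalE (B : traceAlg F) (a : nat -> B) f :
  tr_eval a f = \sum_(m <- msupp f) f@_m *: tmonom_eval a m.
Proof.
by rewrite /tr_eval mmapE; apply: eq_bigr => m _; rewrite /= mulr_algl.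
Qed.

(** The values of one element of the free algebra with trace, in all algebras
    at once.  Identities are manipulated in this form, where they can be read
    as formulas in the elements of an algebra; the element of the free algebra
    is recovered from the closure properties below. *)
Definition trace_law (phi : forall B : traceAlg F, (nat -> B) -> B) : Prop :=
  exists f, forall B a, tr_eval a f = phi B a.

Definition scalar_law (s : forall B : traceAlg F, (nat -> B) -> F) : Prop :=
  trace_law (fun B a => (s B a)%:A).

Lemma trace_law_variety phi (B C : traceAlg F) : trace_law phi -> variety B C ->
  (forall b, phi B b = 0) -> forall c, phi C c = 0.
Proof.
by move=> [f ef] BC phiB c; rewrite -ef; apply: BC => b; rewrite ef phiB.
Qed.

Lemma trace_law_var i : trace_law (fun B a => a i).
Proof.
exists << (mone, fmu i : fmonom nat) : tmonom >> => B a.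
by rewrite tr_evalU /tmonom_eval /= mdom1 big_seq_fset0 scale1r /word_eval
           fmU big_seq1.
Qed.

Lemma trace_law1 : trace_law (fun B a => 1).
Proof. by exists 1 => B a; rewrite rmorph1. Qed.

Lemma trace_lawD phi psi : trace_law phi -> trace_law psi ->
  trace_law (fun B a => phi B a + psi B a).
Proof. by case=> f ef [g eg]; exists (f + g) => B a; rewrite raddfD /= ef eg. Qed.

Lemma trace_lawB phi psi : trace_law phi -> trace_law psi ->
  trace_law (fun B a => phi B a - psi B a).
Proof. by case=> f ef [g eg]; exists (f - g) => B a; rewrite raddfB /= ef eg. Qed.

Lemma trace_lawM phi psi : trace_law phi -> trace_law psi ->
  trace_law (fun B a => phi B a * psi B a).
Proof. by case=> f ef [g eg]; exists (f * g) => B a; rewrite rmorphM /= ef eg. Qed.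

Lemma trace_lawZ s phi : scalar_law s -> trace_law phi ->
  trace_law (fun B a => s B a *: phi B a).
Proof.
by case=> f ef [g eg]; exists (f * g) => B a; rewrite rmorphM /= ef eg mulr_algl.
Qed.

Lemma scalar_law_const c : scalar_law (fun B a => c).
Proof. by exists c%:A => B a; rewrite linearZ rmorph1. Qed.

Lemma scalar_lawD s r : scalar_law s -> scalar_law r ->
  scalar_law (fun B a => s B a + r B a).
Proof.
by case=> f ef [g eg]; exists (f + g) => B a; rewrite raddfD /= ef eg scalerDl.
Qed.

Lemma scalar_lawB s r : scalar_law s -> scalar_law r ->
  scalar_law (fun B a => s B a - r B a).
Proof.
by case=> f ef [g eg]; exists (f - g) => B a; rewrite raddfB /= ef eg scalerBl.
Qed.

Lemma scalar_lawM s r : scalar_law s -> scalar_law r ->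
  scalar_law (fun B a => s B a * r B a).
Proof.
case=> f ef [g eg]; exists (f * g) => B a.
by rewrite rmorphM /= ef eg mulr_algl scalerA.
Qed.

Lemma scalar_lawX s k : scalar_law s -> scalar_law (fun B a => s B a ^+ k).
Proof.
move=> [f ef]; exists (f ^+ k) => B a; rewrite rmorphXn /= ef.
by elim: k => [|k IHk]; rewrite ?expr0 ?scale1r // !exprS IHk mulr_algl scalerA.
Qed.

(** The formal trace, extended linearly from monomials.  It is applied to
    f x_i because the free algebra has no indeterminate for the trace of the
    empty word; the last letter x_i keeps all the words nonempty. *)
Lemma scalar_law_tr phi i : trace_law phi ->
  scalar_law (fun B a => tr B (phi B a * a i)).
Proof.
case=> f ef.
have nz (m : tmonom) : rcons (m.2 : seq nat) i != [::].
  by rewrite -size_eq0 size_rcons.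
have [T eT] : exists T : tmonom -> free_trace_alg F,
    forall m (B : traceAlg F) (a : nat -> B),
    tr_eval a (T m) = (tr B (word_eval a (rcons (m.2 : seq nat) i)))%:A.
  pose w m : nword := exist (fun w : seq nat => w != [::]) _ (nz m).
  exists (fun m => << (ucm (\pi_cword%qT (w m)), mone) : tmonom >>) => m B a.
  rewrite tr_evalU /tmonom_eval /= mdomU big_seq_fset1 cmUU expr1.
  by rewrite cword_evalE /word_eval fm1 big_nil.
pose P (m : tmonom) : free_trace_alg F := << (m.1, mone) : tmonom >>.
exists (\sum_(m <- msupp f) f@_m *: (P m * T m)) => B a.
rewrite -ef [tr_eval a f]tr_evalE mulr_suml [tr _ _]raddf_sum /= scaler_suml.
rewrite raddf_sum; apply: eq_bigr => m _.
rewrite /= tr_evalZ rmorphM /= tr_evalU eT /tmonom_eval /= {1}/word_eval fm1.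
rewrite big_nil -!scalerAl !linearZ /= /word_eval -cats1 big_cat big_seq1 /=.
by rewrite mul1r !scalerA mulrCA mulrA.
Qed.

Lemma scalar_law_tr_var i : scalar_law (fun B a => tr B (a i)).
Proof.
have [f ef] := scalar_law_tr i trace_law1.
by exists f => B a; rewrite ef mul1r.
Qed.

End TraceLaws.

(** * Four trace polynomials *)

Section Forms.
Variables (F : fieldType) (B : traceAlg F).
Implicit Types (x y : B) (s alpha beta : F).

Definition gram x y : F := tr B (x * x) * tr B (y * y) - tr B (x * y) ^+ 2.

(** The Casimir element of the trace form on the span of x and y, with the
    denominator gram x y cleared. *)
Definition casimir x y : B :=
  tr B (y * y) *: (x * x) - (2 * tr B (x * y)) *: (x * y)
  + tr B (x * x) *: (y * y).

(** U_s in the introduction. *)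
Definition casimir_shift s x y : B := s *: casimir x y - gram x y *: 1.

(** On D, at x = diag(a, b), this is
    alpha beta (x - a) (x - b) ((alpha + beta) x - c) where
    c = (2 alpha - beta) a + (2 beta - alpha) b.  The last factor is the one for
    which all the coefficients become polynomials in the traces of x, x^2 and
    x^3. *)
Definition cubic alpha beta x : B :=
  (alpha * beta * (alpha + beta)) *: (x * x * x)
  - (3 * alpha * beta * tr B x) *: (x * x)
  + ((alpha + beta) * tr B x ^+ 2
     + (3 * alpha * beta - (alpha + beta) ^+ 2) * tr B (x * x)) *: x
  - (tr B x ^+ 3 - (alpha + beta) * tr B x * tr B (x * x)
     + alpha * beta * tr B (x * x * x)) *: 1.

Lemma tr_casimir x y : tr B (casimir x y) = 2 * gram x y.
Proof. by rewrite /casimir /gram linearD linearB !linearZ /=; ring. Qed.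

End Forms.

Section FormLaws.
Variable F : fieldType.
Implicit Types (s r alpha beta : F).

(* As scalar_law unfolds to trace_law, trace_lawZ would apply to scalar goals
   indefinitely if the two kinds of goals were not kept apart. *)
Ltac law := repeat match goal with
  | |- scalar_law _ => first [ exact: scalar_law_const | exact: scalar_law_tr_var
      | apply: scalar_lawB | apply: scalar_lawD | apply: scalar_lawM
      | apply: scalar_lawX | apply: scalar_law_tr ]
  | |- trace_law _ => first [ exact: trace_law_var | exact: trace_law1
      | apply: trace_lawB | apply: trace_lawD | apply: trace_lawZ
      | apply: trace_lawM ]
  end.

Lemma law_comm : trace_law (fun (B : traceAlg F) a => a 0 * a 1 - a 1 * a 0).
Proof. law. Qed.

Lemma law_cubic alpha beta : trace_law (fun B a => cubic alpha beta (a 0)).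
Proof. rewrite /cubic; law. Qed.

Lemma law_shiftM s r : trace_law (fun B a =>
  casimir_shift s (a 0) (a 1) * casimir_shift r (a 0) (a 1)).
Proof. rewrite /casimir_shift /casimir /gram; law. Qed.

Lemma law_shift_eigen s r :
  trace_law (fun B a => let U := casimir_shift s (a 0) (a 1) in
    ((s - r) * gram (a 0) (a 1)) *: (U * a 1) - tr B (U * a 1) *: U).
Proof. rewrite /casimir_shift /casimir /gram /=; law. Qed.

End FormLaws.

(** * Identities of the diagonal matrices *)

Section Diag2Identities.
Variables (F : fieldType) (alpha beta : F).
Local Notation D := (D2 alpha beta).
Implicit Types u v : D.

Definition dentry u i : F := diag2_mx u i i.

Lemma dentryD u v i : dentry (u + v) i = dentry u i + dentry v i.
Proof. by rewrite /dentry mxE. Qed.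

Lemma dentryN u i : dentry (- u) i = - dentry u i.
Proof. by rewrite /dentry mxE. Qed.

Lemma dentryZ c u i : dentry (c *: u) i = c * dentry u i.
Proof. by rewrite /dentry mxE. Qed.

Lemma dentry1 i : dentry 1 i = 1.
Proof. by rewrite /dentry mxE eqxx. Qed.

Lemma dentryM u v i : dentry (u * v) i = dentry u i * dentry v i.
Proof.
case: u v => [u Du] [v Dv]; rewrite /dentry /=.
move/diag_mxP: Du => [d ->]; move/diag_mxP: Dv => [e ->].
by rewrite -[_ * _]/(_ *m _) mulmx_diag !mxE eqxx.
Qed.

Lemma dentry_tr u : tr D u = alpha * dentry u 0 + beta * dentry u 1.
Proof. by []. Qed.

Definition dentryE := (dentry_tr, dentryM, dentry1, dentryZ, dentryN, dentryD).

Lemma D2_eq0 u : dentry u 0 = 0 -> dentry u 1 = 0 -> u = 0.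
Proof.
case: u => [u Du]; rewrite /dentry /= => u0 u1; apply: val_inj => /=.
apply/matrixP => i j; rewrite mxE.
have [<-|ij] := eqVneq i j; last by move/is_diag_mxP: Du => ->.
have /orP[/eqP-> //|/eqP-> //] : (i == 0) || (i == 1).
by case: i => [[|[|]]].
Qed.

Lemma D2_comm u v : u * v - v * u = 0.
Proof. by apply: D2_eq0; rewrite !dentryE; ring. Qed.

Lemma D2_cubic u : cubic alpha beta u = 0.
Proof. by apply: D2_eq0; rewrite /cubic !dentryE; ring. Qed.

Let minor u v := dentry u 0 * dentry v 1 - dentry u 1 * dentry v 0.

Lemma D2_gram u v : gram u v = alpha * beta * minor u v ^+ 2.
Proof. by rewrite /gram /minor !dentryE; ring. Qed.

Lemma D2_casimir0 u v : dentry (casimir u v) 0 = beta * minor u v ^+ 2.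
Proof. by rewrite /casimir /minor !dentryE; ring. Qed.

Lemma D2_casimir1 u v : dentry (casimir u v) 1 = alpha * minor u v ^+ 2.
Proof. by rewrite /casimir /minor !dentryE; ring. Qed.

(** The factors are multiples of the first and of the second idempotent. *)
Lemma D2_shiftM u v : casimir_shift beta u v * casimir_shift alpha u v = 0.
Proof.
by apply: D2_eq0;
   rewrite /casimir_shift !(dentryE, D2_casimir0, D2_casimir1, D2_gram); ring.
Qed.

(** Being a multiple of a primitive idempotent, U is an eigenvector of the
    multiplication by v, and the trace detects the eigenvalue. *)
Lemma D2_shift_eigen s r u v :
  (s, r) = (alpha, beta) \/ (s, r) = (beta, alpha) ->
  let U := casimir_shift s u v in
  ((s - r) * gram u v) *: (U * v) - tr D (U * v) *: U = 0.
Proof.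
by case=> -[-> ->]; apply: D2_eq0;
   rewrite /casimir_shift !(dentryE, D2_casimir0, D2_casimir1, D2_gram); ring.
Qed.

End Diag2Identities.

(** * Embeddings of the diagonal matrices *)

Lemma tr_eval_morph (F : fieldType) (B C : traceAlg F)
    (phi : {lrmorphism B -> C}) : (forall u, tr C (phi u) = tr B u) ->
  forall a f, phi (tr_eval a f) = tr_eval (phi \o a) f.
Proof.
move=> trphi a f.
have ew w : phi (word_eval a w) = word_eval (phi \o a) w by rewrite rmorph_prod.
have et c : cword_eval a c = cword_eval (phi \o a) c.
  by rewrite /cword_eval -ew trphi.
rewrite !tr_evalE raddf_sum; apply: eq_bigr => m _.
rewrite [LHS]linearZ /=; congr (_ *: _).
rewrite /tmonom_eval [LHS]linearZ /= ew; congr (_ *: _).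
by apply: eq_bigr => c _; rewrite et.
Qed.

Lemma variety_embed (F : fieldType) (B C : traceAlg F)
    (phi : {lrmorphism B -> C}) :
  injective phi -> (forall u, tr C (phi u) = tr B u) -> variety C B.
Proof.
move=> injphi trphi f Cf a; apply: injphi.
by rewrite (tr_eval_morph trphi) Cf raddf0.
Qed.

Section Diag2Embedding.
Variables (F : fieldType) (alpha beta : F) (C : traceAlg F) (e0 e1 : C).
Hypotheses (eS : e0 + e1 = 1) (eM : e0 * e1 = 0).

Definition diag2_embed (u : D2 alpha beta) : C :=
  dentry u 0 *: e0 + dentry u 1 *: e1.

Lemma diag2_embed_linear : linear diag2_embed.
Proof.
move=> c u v; rewrite /diag2_embed !dentryD !dentryZ !scalerDl scalerDr.
by rewrite !scalerA addrACA.
Qed.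

Lemma diag2_embed_monoid : monoid_morphism diag2_embed.
Proof.
have e1E : e1 = 1 - e0 by rewrite -eS addrC addKr.
have e00 : e0 * e0 = e0.
  by move: eM; rewrite e1E mulrBr mulr1 => /eqP; rewrite subr_eq0 => /eqP.
have e10 : e1 * e0 = 0 by rewrite e1E mulrBl mul1r e00 subrr.
have e11 : e1 * e1 = e1 by rewrite {1}e1E mulrBl mul1r eM subr0.
split; first by rewrite /diag2_embed !dentry1 !scale1r.
move=> u v; rewrite /diag2_embed !dentryM mulrDl !mulrDr -!scalerAl -!scalerAr.
by rewrite e00 eM e10 e11 !scaler0 addr0 add0r !scalerA.
Qed.

HB.instance Definition _ :=
  GRing.isLinear.Build F (D2 alpha beta) C *:%R diag2_embed diag2_embed_linear.
HB.instance Definition _ :=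
  GRing.isMonoidMorphism.Build (D2 alpha beta) C diag2_embed diag2_embed_monoid.

(** Injectivity comes from the trace: as alpha and beta are not 0, the trace
    form of D is nondegenerate, and the kernel lies in its radical. *)
Lemma variety_diag2_embed : alpha != 0 -> beta != 0 ->
  tr C e0 = alpha -> tr C e1 = beta -> variety C (D2 alpha beta).
Proof.
move=> nza nzb te0 te1.
have trphi u : tr C (diag2_embed u) = tr (D2 alpha beta) u.
  by rewrite raddfD /= !linearZ /= te0 te1 dentry_tr ![dentry _ _ * _]mulrC.
apply: (variety_embed (phi := diag2_embed)) => //; apply: raddf_inj => u phi0.
have tM v : tr C (diag2_embed (u * v)) = 0 by rewrite rmorphM /= phi0 mul0r raddf0.
pose v i : D2 alpha beta := Diag2 (diag_mx_is_diag (\row_j (i == j)%:R)).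
have vE i j : dentry (v i) j = (i == j)%:R by rewrite /dentry /= !mxE eqxx.
have := tM (v 0); have := tM (v 1); rewrite !trphi !dentry_tr !dentryM !vE /=.
rewrite !mulr1 !mulr0 addr0 add0r => /eqP; rewrite mulf_eq0 (negPf nzb) => /eqP u1.
move=> /eqP; rewrite mulf_eq0 (negPf nza) => /eqP u0.
exact: D2_eq0.
Qed.

End Diag2Embedding.

(** * The algebras satisfying the identities of the diagonal matrices *)

Lemma natr_neq0 (F : fieldType) n : [pchar F] =i pred0 -> (0 < n)%N ->
  n%:R != 0 :> F.
Proof. by move=> charF; rewrite lt0n ((pcharf0P F).1 charF). Qed.

Section Diag2Variety.
Variables (F : fieldType) (alpha beta : F) (A : traceAlg F).
Hypotheses (nz_alpha : alpha != 0) (nz_beta : beta != 0).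
Hypothesis neq_ab : alpha != beta.
Hypothesis D2A : variety (D2 alpha beta) A.

Lemma variety_comm (x y : A) : x * y = y * x.
Proof.
apply/eqP; rewrite -subr_eq0; apply/eqP.
pose a i := if i == 0%N then x else y.
by apply: (trace_law_variety (law_comm F) D2A) (a) => b; apply: D2_comm.
Qed.

Lemma variety_cubic (x : A) : cubic alpha beta x = 0.
Proof.
by apply: (trace_law_variety (law_cubic alpha beta) D2A) (fun=> x) => b;
   apply: D2_cubic.
Qed.

(** U_beta and U_alpha are taken at y = 1.  Since t(U_s) = (2 s - t(1)) G, the
    eigenvector identity reads (t(1) - alpha - beta) G U_s = 0; both U_s cannot
    vanish, as alpha U_beta - beta U_alpha = (beta - alpha) G.  The same relation
    shows that the scaled elements alpha U_beta and - beta U_alpha add up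
    to 1. *)
Lemma diag2_of_gram (x : A) : gram x 1 != 0 -> variety A (D2 alpha beta).
Proof.
set G := gram x 1 => nzG; pose a i := if i == 0%N then x else 1.
pose U s := casimir_shift s x 1.
have UM : U beta * U alpha = 0.
  by apply: (trace_law_variety (law_shiftM beta alpha) D2A) (a) => b;
     apply: D2_shiftM.
have trU s : tr A (U s) = (2 * s - tr A 1) * G.
  by rewrite /U /casimir_shift linearB !linearZ /= tr_casimir -/G; ring.
have Ueig s r : (s, r) = (alpha, beta) \/ (s, r) = (beta, alpha) ->
    ((tr A 1 - alpha - beta) * G) *: U s = 0.
  move=> sr.
  have : ((s - r) * G) *: (U s * 1) - tr A (U s * 1) *: U s = 0.
    by apply: (trace_law_variety (law_shift_eigen s r) D2A) (a) => b;
       apply: D2_shift_eigen.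
  rewrite mulr1 -scalerBl trU => <-; congr (_ *: _).
  by case: sr => -[-> ->]; ring.
have Ucomb : alpha *: U beta - beta *: U alpha = ((beta - alpha) * G) *: 1.
  rewrite /U /casimir_shift -/G !scalerBr !scalerA [beta * alpha]mulrC opprB.
  by rewrite addrC addrA subrK -scalerBl -mulrBl.
have nzH : (beta - alpha) * G != 0.
  by apply: mulf_neq0 => //; rewrite subr_eq0 eq_sym.
have tr1 : tr A 1 = alpha + beta.
  apply/eqP; rewrite -subr_eq0 opprD addrA; apply/negPn/negP => nz1.
  have U0 s r : (s, r) = (alpha, beta) \/ (s, r) = (beta, alpha) -> U s = 0.
    move=> sr; have /eqP := Ueig _ _ sr.
    by rewrite scaler_eq0 mulf_eq0 (negPf nz1) (negPf nzG) => /eqP.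
  have Ua : U alpha = 0 by apply: (U0 _ beta); left.
  have Ub : U beta = 0 by apply: (U0 _ alpha); right.
  move/eqP: Ucomb; rewrite Ua Ub !scaler0 subr0 eq_sym scaler_eq0 (negPf nzH).
  by rewrite oner_eq0.
apply: (@variety_diag2_embed _ _ _ _
          ((alpha / ((beta - alpha) * G)) *: U beta)
          ((- beta / ((beta - alpha) * G)) *: U alpha)) => //.
- rewrite mulNr scaleNr ![_ / ((beta - alpha) * G)]mulrC -!scalerA -scalerBr.
  by rewrite Ucomb scalerA mulVf ?scale1r.
- by rewrite -scalerAl -scalerAr UM !scaler0.
- by rewrite linearZ /= trU tr1; field; rewrite nzG subr_eq0 eq_sym.
- by rewrite linearZ /= trU tr1; field; rewrite nzG subr_eq0 eq_sym.
Qed.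

End Diag2Variety.

(** * Degenerate trace forms *)

Lemma degenerate_trM (F : fieldType) (A : traceAlg F) :
  [pchar F] =i pred0 -> (forall x : A, gram x 1 = 0) ->
  forall x y : A, tr A 1 * tr A (x * y) = tr A x * tr A y.
Proof.
move=> charF gram0 x y.
have sq z : tr A 1 * tr A (z * z) = tr A z ^+ 2.
  by apply/eqP; rewrite -subr_eq0 -(gram0 z) /gram !mulr1 [tr A 1 * _]mulrC.
apply: (mulfI (natr_neq0 charF (n := 2) isT)).
transitivity (tr A 1 * tr A ((x + y) * (x + y))
              - tr A 1 * tr A (x * x) - tr A 1 * tr A (y * y)).
  by rewrite mulrDr !mulrDl !raddfD /= (trC y x); ring.
by rewrite !sq raddfD /=; ring.
Qed.

Section NilKernel.
Variables (F : fieldType) (alpha beta : F) (C : comAlgType F).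
Variables (t : {scalar C}) (tC : forall x y : C, t (x * y) = t (y * x)).
Local Notation A := (TraceAlg tC).
Hypotheses (nz_alpha : alpha != 0) (nz_beta : beta != 0).
Hypothesis charF : [pchar F] =i pred0.
Hypothesis cubic0 : forall x : A, cubic alpha beta x = 0.
Hypothesis trM : forall x y : C, t 1 * t (x * y) = t x * t y.
Hypothesis nz1 : t 1 != 0.

(** The traces of all the powers of 1 + c n are equal to t(1), so that the
    coefficients of the cubic at 1 + c n are independent of c.  Comparing its
    values at c = 1, -1, 0 gives (alpha + beta - t(1)) n^2 = 0, while the cubic
    at n itself is a multiple of (alpha + beta) n^3.  As t(1) is not 0, one of
    the two coefficients is not 0. *)
Lemma ker_tr_cube (n : C) : t n = 0 -> n * n * n = 0.
Proof.
move=> tn.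
have tnn y : t (n * y) = 0 by apply: (mulfI nz1); rewrite trM tn mul0r mulr0.
have scaleE c (u : C) : c *: u = in_alg C c * u by rewrite mulr_algl.
pose g := t 1; pose ab := alpha * beta.
have n3 : (ab * (alpha + beta)) *: (n * n * n) = 0.
  rewrite -[RHS](cubic0 n) /cubic /= -mulrA !tnn tn.
  by rewrite !(mulr0, expr0n, addr0, subr0, scale0r).
have cubicE c : cubic alpha beta (1 + c *: n : A) =
  (ab * (alpha + beta)) *: ((1 + c *: n) * (1 + c *: n) * (1 + c *: n))
   - (3 * ab * g) *: ((1 + c *: n) * (1 + c *: n))
  + ((alpha + beta) * g ^+ 2 + (3 * ab - (alpha + beta) ^+ 2) * g) *: (1 + c *: n)
  - (g ^+ 3 - (alpha + beta) * g * g + ab * g) *: 1.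
  have E1 : t (1 + c *: n) = g by rewrite linearD linearZ /= tn mulr0 addr0.
  have E2 (u : C) : t ((1 + c *: n) * u) = t u.
    by rewrite mulrDl mul1r -scalerAl linearD linearZ /= tnn mulr0 addr0.
  have E3 : t ((1 + c *: n) * (1 + c *: n) * (1 + c *: n)) = g.
    by rewrite -mulrA !E2 E1.
  by rewrite /cubic /= E3 E2 E1 /ab !mulrA.
have : (6 * ab * (alpha + beta - g)) *: (n * n) = 0.
  (* The second difference in c isolates the terms of degree two. *)
  transitivity (cubic alpha beta (1 + 1 *: n : A)
     + cubic alpha beta (1 + (-1) *: n : A)
     - cubic alpha beta (1 + 0 *: n : A) - cubic alpha beta (1 + 0 *: n : A)).
    by rewrite !cubicE !scaleE; ring.
  by rewrite !cubic0 !subr0 addr0.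
have nz6 : 6%:R != 0 :> F := natr_neq0 charF (n := 6) isT.
move/eqP; rewrite scaler_eq0 !mulf_eq0 (negPf nz6) (negPf nz_alpha) (negPf nz_beta).
case/orP=> [|/eqP->]; last by rewrite mul0r.
rewrite subr_eq0 => /eqP ag; move/eqP: n3.
rewrite scaler_eq0 ag !mulf_eq0 (negPf nz1) (negPf nz_alpha) (negPf nz_beta).
by move/eqP.
Qed.

Lemma ker_tr_mul3 (u v w : C) : t u = 0 -> t v = 0 -> t w = 0 -> u * v * w = 0.
Proof.
move=> tu tv tw.
have nz6 : 6%:R != 0 :> F := natr_neq0 charF (n := 6) isT.
have cub x : t x = 0 -> x * x * x = 0 by exact: ker_tr_cube.
apply/eqP; have := scaler_eq0 (6%:R : F) (u * v * w); rewrite (negPf nz6) /= => <-.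
apply/eqP; transitivity ((u + v + w) * (u + v + w) * (u + v + w)
  - (u + v) * (u + v) * (u + v) - (u + w) * (u + w) * (u + w)
  - (v + w) * (v + w) * (v + w) + u * u * u + v * v * v + w * w * w).
  by rewrite scaler_nat; ring.
by rewrite !cub ?raddfD /= ?tu ?tv ?tw ?addr0 // !subr0.
Qed.

End NilKernel.

(** * Bounding codimensions *)

Section QuotientDim.
Variables (F : fieldType) (E : lmodType F) (V W : E -> Prop).
Variables (I : finType) (S : {pred I}) (psi : I -> {scalar E}).
Hypotheses (V0 : V 0) (VP : forall c x y, V x -> V y -> V (c *: x + y)).
Hypothesis WZ : forall c x, W x -> W (c *: x).
Hypothesis psiP : forall x, V x -> (forall i, i \in S -> psi i x = 0) -> W x.

Let free_mod d (v : 'I_d -> E) :=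
  (forall i, V (v i)) /\
  (forall c : 'I_d -> F, W (\sum_i c i *: v i) -> forall i, c i = 0).

Let V_comb d (v : 'I_d -> E) (c : 'I_d -> F) :
  (forall i, V (v i)) -> V (\sum_i c i *: v i).
Proof.
move=> Vv; apply: big_ind => // [x y Vx Vy|i _].
  by rewrite -[x]scale1r; apply: VP.
by rewrite -[_ *: _]addr0; apply: VP.
Qed.

(* A nonzero row u killed by the matrix of the psi_k(v_i) is a relation modulo W. *)
Let free_mod_le d (v : 'I_d -> E) : free_mod v -> (d <= #|S|)%N.
Proof.
case=> Vv freev; rewrite leqNgt; apply/negP => ltd.
pose M : 'M[F]_(d, #|S|) := \matrix_(i, j) psi (enum_val j) (v i).
have /rowV0Pn[u /sub_kermxP uM nzu] : kermx M != 0.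
  rewrite kermx_eq0 /row_free neq_ltn (leq_ltn_trans _ ltd) //.
  exact: rank_leq_col.
case/negP: nzu; apply/eqP/rowP => i; rewrite mxE.
apply: (freev (u 0)); apply: psiP (V_comb _ Vv) _ => k kS.
move/rowP/(_ (enum_rank_in kS k)): uM; rewrite !mxE => <-.
rewrite linear_sum; apply: eq_bigr => j _.
by rewrite linearZ /= mxE enum_rankK_in.
Qed.

(** The linear forms psi_i embed the quotient of V by their common kernel, which
    W contains, into a space of dimension #|S|.  The basis modulo W is an
    independent family of maximal size. *)
Lemma quotient_dim_le : exists2 d, quotient_dim V W d & (d <= #|S|)%N.
Proof.
have free0 : exists v : 'I_0 -> E, free_mod v.
  by exists (fun=> 0); split=> [[]//|c _ []].
have [d [v freev] maxd] : exists2 d, exists v : 'I_d -> E, free_mod v &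
    ~ exists v : 'I_d.+1 -> E, free_mod v.
  apply: NNPP => noMax.
  have all_free d : exists v : 'I_d -> E, free_mod v.
    elim: d => // d IHd; apply: NNPP => noS; apply: noMax.
    by exists d.
  by have [v /free_mod_le] := all_free #|S|.+1; rewrite ltnn.
exists d; last exact: free_mod_le freev.
exists v; split; [exact: freev.1 | exact: freev.2 |] => x Vx.
pose v' (i : 'I_d.+1) := if unlift ord_max i is Some j then v j else x.
have v'sum c : \sum_i c i *: v' i =
    \sum_i c (lift ord_max i) *: v i + c ord_max *: x.
  rewrite (bigD1_ord ord_max) //= /v' unlift_none addrC; congr (_ + _).
  by apply: eq_bigr => i _; rewrite liftK.
apply: NNPP => nospan; apply: maxd; exists v'; split=> [i|c Wc i].
  by rewrite /v'; case: unlift => // j; apply: freev.1.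
have c0 : c ord_max = 0.
  apply/eqP/negP => /negP nzc; apply: nospan.
  exists (fun i => - (c ord_max)^-1 * c (lift ord_max i)).
  have := WZ (c ord_max)^-1 Wc; rewrite v'sum scalerDr scalerA mulVf // scale1r.
  rewrite addrC scaler_sumr -sumrN; congr (W (_ + _)).
  by apply: eq_bigr => j _; rewrite mulNr scaleNr opprK scalerA.
case: (unliftP ord_max i) => [j ->|-> //].
by move: Wc; rewrite v'sum c0 scale0r addr0 => /freev.2; apply.
Qed.

End QuotientDim.

Section Growth.
Variables (F : fieldType) (A : traceAlg F).

Section LinearExtension.
Variable h : tmonom -> F.

Definition tmonom_form (f : free_trace_alg F) : F := mmap idfun h f.

Lemma tmonom_form_scalar : scalar tmonom_form.
Proof.
move=> c f g; rewrite /tmonom_form mmapD; congr (_ + _).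
rewrite (mmapEw (msuppZ_le _ _)) mmapE big_distrr /=.
by apply: eq_bigr => k _; rewrite mcoeffZ mulrA.
Qed.

HB.instance Definition _ := GRing.isLinear.Build F (free_trace_alg F) F *%R
  tmonom_form tmonom_form_scalar.

End LinearExtension.

Lemma MT0 n : MT n (0 : free_trace_alg F).
Proof. by move=> m; rewrite msupp0. Qed.

Lemma MT_comb n c (f g : free_trace_alg F) :
  MT n f -> MT n g -> MT n (c *: f + g).
Proof.
move=> Mf Mg m /(fsubsetP (msuppD_le _ _)); rewrite in_fsetU => /orP[].
  by move/(fsubsetP (msuppZ_le _ _)); apply: Mf.
exact: Mg.
Qed.

(** The codimension is at most the number of functions g_i needed to express
    all the multilinear trace monomials as functions on A: an element of MT_n
    whose coordinates on the g_i vanish is an identity. *)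
Lemma growth_of_coordinates (p : {poly rat}) (I : nat -> finType)
    (S : forall n, {pred I n}) (coef : forall n, I n -> tmonom -> F)
    (g : forall n, I n -> (nat -> A) -> A) :
    (forall n m a, multilinear_tmonom n m ->
       tmonom_eval a m = \sum_(i in S n) coef n i m *: g n i a) ->
    (forall n, #|S n|%:R <= p.[n%:R]) ->
  polynomial_growth A.
Proof.
move=> evalE leSp; exists p => n.
have [d codim ledS] : exists2 d, trace_codim A n d & (d <= #|S n|)%N.
  apply: (quotient_dim_le (psi := fun i => tmonom_form (coef n i))).
  - exact: MT0.
  - exact: MT_comb.
  - move=> c f [Mf Af]; split; last by move=> a; rewrite tr_evalZ Af scaler0.
    by rewrite -[_ *: _]addr0; apply: MT_comb => //; apply: MT0.
  - move=> f Mf f0; split=> // a.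
    transitivity (\sum_(i in S n) tmonom_form (coef n i) f *: g n i a).
      rewrite tr_evalE.
      under [RHS]eq_bigr do rewrite /tmonom_form mmapE scaler_suml.
      rewrite exchange_big /= big_seq [RHS]big_seq; apply: eq_bigr => m /Mf mm.
      rewrite (evalE n m a mm) scaler_sumr; apply: eq_bigr => i _.
      by rewrite scalerA.
    by apply: big1 => i iS; rewrite [tmonom_form _ _]f0 // scale0r.
by exists d => //; apply: le_trans (leSp n); rewrite ler_nat.
Qed.

End Growth.

(** * Growth of commutative algebras with degenerate trace *)

Lemma prod_count (R : comPzSemiRingType) n (w : seq nat) (f : nat -> R) :
  all (fun i => (i < n)%N) w ->
  \prod_(i <- w) f i = \prod_(i < n) f i ^+ count_mem (i : nat) w.
Proof.
elim: w => [|x w IHw] /=; first by rewrite big_nil big1.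
case/andP=> ltx /IHw IH; rewrite big_cons IH.
under [RHS]eq_bigr do rewrite exprD; rewrite big_split /=; congr (_ * _).
rewrite (bigD1 (Ordinal ltx)) //= eqxx big1 ?mulr1 // => i ne.
by rewrite -val_eqE /= eq_sym in ne; rewrite (negPf ne).
Qed.

Lemma multilinear_letters n (m : tmonom) : multilinear_tmonom n m ->
  all (fun i => (i < n)%N) m.2 /\
  {in finsupp m.1, forall c, all (fun i => (i < n)%N) (cletters c)}.
Proof.
move=> mm; split=> [|c cm]; apply/allP => i ic.
  by rewrite -[(i < n)%N]lt0b -mm /tdeg addn_gt0 orbC -has_count has_pred1 ic.
rewrite -[(i < n)%N]lt0b -mm /tdeg addn_gt0 (big_fsetD1 c) //=.
by rewrite addn_gt0 muln_gt0 lt0n cmE_neq0 cm -has_count has_pred1 ic.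
Qed.

Section CommutativeGrowth.
Variables (F : fieldType) (C : comAlgType F) (t : {scalar C}).
Variable tC : forall x y : C, t (x * y) = t (y * x).
Local Notation A := (TraceAlg tC).

(** Only the monomials without traces survive, and they all take the value
    x_1 ... x_n. *)
Lemma growth_trace0 : (forall x, t x = 0) -> polynomial_growth A.
Proof.
move=> t0.
apply: (@growth_of_coordinates _ A 1 (fun=> unit) (fun=> predT)
  (fun _ _ m => (m.1 == mone)%:R) (fun n _ a => \prod_(i < n) a i)); last first.
  by move=> n; rewrite cardT enumT unlock hornerC.
move=> n m a mm; rewrite big_const cardT enumT unlock /= addr0.
have [w_n _] := multilinear_letters mm.
rewrite /tmonom_eval; have [m1|m1] := eqVneq m.1 mone; last first.
  have [c cm] : exists c, c \in finsupp m.1.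
    apply/fset0Pn; apply: contra m1 => /eqP m0; apply/cmP => c.
    by apply/eqP; rewrite cm1 cmE_eq0 m0.
  rewrite (big_fsetD1 c) //= /cword_eval /= t0 expr0n cmE_eq0 cm /=.
  by rewrite mul0r !scale0r.
rewrite m1 mdom1 big_seq_fset0 !scale1r /word_eval.
rewrite [LHS](prod_count (R := C) a w_n); apply: eq_bigr => i _.
have := mm i; rewrite /tdeg m1 mdom1 big_seq_fset0 add0n ltn_ord => ->.
by rewrite expr1.
Qed.

Hypothesis nz1 : t 1 != 0.
Hypothesis trM : forall x y, t 1 * t (x * y) = t x * t y.
Hypothesis ker3 : forall x y z, t x = 0 -> t y = 0 -> t z = 0 -> x * y * z = 0.

Definition trace_char (x : C) : F := t x / t 1.
Local Notation lam := trace_char.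

Lemma trace_charM x y : lam (x * y) = lam x * lam y.
Proof.
apply: (mulfI nz1); rewrite mulrA trM /trace_char; field.
by rewrite nz1.
Qed.

Lemma trace_char_prod (w : seq nat) (a : nat -> C) :
  lam (\prod_(i <- w) a i) = \prod_(i <- w) lam (a i).
Proof.
elim: w => [|i w IHw]; first by rewrite !big_nil /trace_char divff.
by rewrite !big_cons trace_charM IHw.
Qed.

Definition ker_part x : C := x - (lam x)%:A.

Lemma tr_ker_part x : t (ker_part x) = 0.
Proof. by rewrite /ker_part linearB linearZ /= /trace_char divfK ?subrr. Qed.

Definition small_sets n := [set J : {set 'I_n} | (#|J| < 3)%N].

Lemma card_small_sets n : (#|small_sets n| <= 1 + n + n ^ 2)%N.
Proof.
have sub : small_sets n \subset ([set J : {set 'I_n} | #|J| == 0]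
    :|: [set J : {set 'I_n} | #|J| == 1] :|: [set J : {set 'I_n} | #|J| == 2])%N.
  by apply/subsetP => J; rewrite !inE; case: #|J| => [|[|[]]].
apply: leq_trans (subset_leq_card sub) _.
apply: leq_trans (leq_card_setU _ _) _; rewrite leq_add //.
  apply: leq_trans (leq_card_setU _ _) _.
  by rewrite !card_draws card_ord bin0 bin1.
by rewrite card_draws card_ord bin2; nia.
Qed.

Definition tdeg_in_traces n (m : tmonom) (i : 'I_n) :=
  (\sum_(c <- finsupp m.1) m.1 c * count_mem (i : nat) (cletters c))%N.

Lemma trace_partE n (m : tmonom) (a : nat -> A) : multilinear_tmonom n m ->
  \prod_(c <- finsupp m.1) cword_eval a c ^+ m.1 c =
  t 1 ^+ mdeg m.1 * \prod_(i < n) lam (a i) ^+ tdeg_in_traces m i.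
Proof.
move=> mm; have [_ c_n] := multilinear_letters mm.
under [X in _ = _ * X]eq_bigr do rewrite /tdeg_in_traces -prodrXr.
rewrite exchange_big /= mdegE -prodrXr -big_split /= big_seq [RHS]big_seq.
apply: eq_bigr => c /c_n cn.
have -> : cword_eval a c = t 1 * \prod_(i <- cletters c) lam (a i).
  by rewrite -trace_char_prod /trace_char mulrC divfK.
rewrite exprMn; congr (_ * _).
rewrite (prod_count _ cn) -prodrXl; apply: eq_bigr => i _.
by rewrite -exprM mulnC.
Qed.

(** In a multilinear monomial x_i occurs exactly once: inside a trace, where it
    contributes lam(x_i), or outside, where it contributes x_i itself. *)
Lemma multilinear_factor n (m : tmonom) (a : nat -> C) (i : 'I_n) :
  multilinear_tmonom n m ->
  lam (a i) ^+ tdeg_in_traces m i *: a i ^+ count_mem (i : nat) (m.2 : seq nat) =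
  (count_mem (i : nat) (m.2 : seq nat))%:R *: ker_part (a i) + (lam (a i))%:A.
Proof.
move/(_ (i : nat)); rewrite /tdeg -/(tdeg_in_traces m i) ltn_ord.
case: (count_mem _ _) => [|[|k]].
- by rewrite addn0 => ->; rewrite expr1 expr0 scale0r add0r.
- rewrite addn1 => -[->]; rewrite expr0 expr1 !scale1r.
  by rewrite /ker_part subrK.
- by rewrite !addnS.
Qed.

(** Expanding the product over i of the factors above gives a sum over the sets
    J of indices at which the component in ker t is taken; three factors in
    ker t annihilate each other, which leaves the sets with at most two
    elements. *)
Lemma growth_character : polynomial_growth A.
Proof.
pose b (m : tmonom) i : F := (count_mem i (m.2 : seq nat))%:R.
pose g n (J : {set 'I_n}) (a : nat -> A) : A :=
  \prod_(i < n) (if i \in J then ker_part (a i) else (lam (a i))%:A).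
apply: (@growth_of_coordinates _ A (1 + 'X + 'X ^+ 2) (fun n => {set 'I_n})
  (fun n => mem (small_sets n))
  (fun n J m => t 1 ^+ mdeg m.1 * \prod_(i < n) (if i \in J then b m i else 1)) g);
    last first.
  move=> n; rewrite !hornerE -[1]/(1%:R) -natrX -!natrD ler_nat.
  exact: card_small_sets.
move=> n m a mm; have [w_n _] := multilinear_letters mm.
rewrite /tmonom_eval (trace_partE _ mm) /word_eval.
rewrite [X in _ *: X](prod_count (R := C) a w_n) -scalerA -scaler_prod.
under eq_bigr => i _ do rewrite (multilinear_factor _ _ mm).
rewrite bigA_distr /= scaler_sumr (bigID (fun J => J \in small_sets n)) /=.
rewrite [X in _ + X]big1 ?addr0 => [|J].
  apply: eq_bigr => J _; rewrite -scalerA; congr (_ *: _).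
  rewrite /g -scaler_prod; apply: eq_bigr => i _.
  by case: (i \in J); rewrite ?scale1r.
rewrite inE -leqNgt => /card_gt2P[i [j [k [[iJ jJ kJ] [ij jk ki]]]]].
rewrite (bigD1 i) //= (bigD1 j) 1?eq_sym //= (bigD1 k) /=; last first.
  by rewrite ki eq_sym jk.
rewrite iJ jJ kJ.
have vanish (x y z r : C) : t x = 0 -> t y = 0 -> t z = 0 ->
    x * (y * (z * r)) = 0.
  by move=> x0 y0 z0; rewrite !mulrA (ker3 x0 y0 z0) mul0r.
have trZ c x : t (c *: ker_part x) = 0 by rewrite linearZ /= tr_ker_part mulr0.
by rewrite [X in _ *: X](vanish _ _ _ _ (trZ _ _) (trZ _ _) (trZ _ _)) scaler0.
Qed.

End CommutativeGrowth.

Lemma growth_degenerate (F : fieldType) (alpha beta : F) (C : comAlgType F)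
    (t : {scalar C}) (tC : forall x y : C, t (x * y) = t (y * x)) :
  alpha != 0 -> beta != 0 -> [pchar F] =i pred0 ->
  (forall x : TraceAlg tC, cubic alpha beta x = 0) ->
  (forall x : TraceAlg tC, gram x 1 = 0) ->
  polynomial_growth (TraceAlg tC).
Proof.
move=> nza nzb charF cubic0 gram0.
have trM (x y : C) : t 1 * t (x * y) = t x * t y.
  exact: (degenerate_trM charF gram0).
have [t1|nz1] := eqVneq (t 1) 0.
  apply: growth_trace0 => x; apply/eqP; rewrite -[_ == 0]orbb -mulf_eq0.
  by rewrite -trM t1 mul0r.
apply: growth_character => // x y z.
exact: (ker_tr_mul3 nza nzb charF cubic0 trM nz1).
Qed.

(** * Proper subvarieties *)

Theorem corollary32 (F : fieldType) (charF : [pchar F] =i pred0)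
    (alpha beta : F) (alpha_neq0 : alpha != 0) (beta_neq0 : beta != 0)
    (alpha_neq_beta : alpha != beta)
    (A : falgType F) (t : {scalar A}) (tC : forall a b : A, t (a * b) = t (b * a))
    (properA : proper_subvariety (variety (@TraceAlg F A t tC))
                                 (variety (D2 alpha beta))) :
  polynomial_growth (@TraceAlg F A t tC).
Proof.
have [subA [B D2B notAB]] := properA.
have D2A : variety (D2 alpha beta) (TraceAlg tC) by apply: subA.
have gram0 (x : TraceAlg tC) : gram x 1 = 0.
  apply/eqP/negPn/negP => /(diag2_of_gram alpha_neq0 beta_neq0 alpha_neq_beta D2A).
  by move=> AD2; apply: notAB => f /AD2 /D2B.
have comm (x y : A) : x * y = y * x := variety_comm D2A x y.
pose C : comAlgType F :=
  HB.pack (Falgebra.sort A) (GRing.PzSemiRing_hasCommutativeMul.Build A comm).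
exact: (@growth_degenerate F alpha beta C t tC alpha_neq0 beta_neq0 charF
          (variety_cubic D2A) gram0).
Qed.
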